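(* Let $V=V_1\otimes V_1$, where $V_1$ is the standard $2$-dimensional representation of $\mathrm{GL}_2(\mathbb F_2)$ over $\overline{\mathbb F}_2$ with basis $\{X,Y\}$. Let $$\mathbf 1=\langle X\otimes Y-Y\otimes X\rangle,\qquad \mathrm{std}=\langle X\otimes X+X\otimes Y-Y\otimes X,\ Y\otimes Y+X\otimes Y-Y\otimes X\rangle,$$ which are subrepresentations of $V$ isomorphic to the trivial representation and to the standard representation, respectively, with $\mathbf 1\cap\mathrm{std}=0$. Then the socle filtration of $V$ is $$0\subseteq \mathbf 1\oplus\mathrm{std}\subseteq V;$$ that is, the socle of $V$ is $\mathbf 1\oplus\mathrm{std}$ and the quotient $V/(\mathbf 1\oplus\mathrm{std})$ is semisimple.
   Context: All representations are over an algebraic closure $\overline{\mathbb F}_2$ of $\mathbb F_2$, and spans are over $\overline{\mathbb F}_2$. The representation $V_1$ is the space of homogeneous linear polynomials in $X,Y$ with $\begin{pmatrix}a&b\\c&d\end{pmatrix}\cdot X=aX+cY$ and $\begin{pmatrix}a&b\\c&d\end{pmatrix}\cdot Y=bX+dY$; $\mathrm{GL}_2(\mathbb F_2)$ acts diagonally on $V_1\otimes V_1$. The socle of a finite-dimensional representation is the sum of its irreducible subrepresentations. The socle filtration is $0=\mathrm{soc}^0\subseteq\mathrm{soc}^1\subseteq\cdots$, where $\mathrm{soc}^{i+1}/\mathrm{soc}^i$ is the socle of $V/\mathrm{soc}^i$. *)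

(* Defs.v *)
From HB Require Import structures.
From mathcomp Require Import all_boot all_order all_algebra all_fingroup.
From mathcomp Require Import all_solvable all_field all_character.

Set Implicit Arguments.
Unset Strict Implicit.
Unset Printing Implicit Defensive.

Import GRing.Theory.
Local Open Scope ring_scope.

Section SocleFiltration.

Variables (F : decFieldType) (gT : finGroupType) (G : {group gT}) (n : nat).
Variable rG : mx_representation F G n.

(* The preimage in V of soc(V / U). *)
Definition soc_next (U : 'M[F]_n) (modU : mxmodule rG U) : 'M[F]_n :=
  (U + val_factmod (Socle (DecSocleType (factmod_repr modU))))%MS.

Lemma soc_next_module (U : 'M[F]_n) (modU : mxmodule rG U) :
  mxmodule rG (soc_next modU).
Proof.
apply/mxmoduleP=> x Gx; rewrite /soc_next; set S := Socle _.
rewrite addsmxMr addsmx_sub (submx_trans (mxmoduleP modU x Gx)) ?addsmxSl //=.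
rewrite -(add_sub_fact_mod U (val_factmod S *m rG x)) addmx_sub_adds //.
  exact: val_submodP.
rewrite -[val_factmod (in_factmod _ _)]val_factmodJ // val_factmodS.
exact: (mxmoduleP (Socle_module (DecSocleType (factmod_repr modU)))).
Qed.

Fixpoint soc_filtration (i : nat) : {U : 'M[F]_n | mxmodule rG U} :=
  if i is j.+1 then
    let U := soc_filtration j in
    exist _ (soc_next (svalP U)) (soc_next_module (svalP U))
  else exist _ 0 (mxmodule0 rG n).

Definition soc (i : nat) : 'M[F]_n := sval (soc_filtration i).

End SocleFiltration.

Section StandardRepresentation.

Variables (F : fieldType) (iota : {rmorphism 'F_2 -> F}).

Local Notation G := ('GL_2(2)%G).

Lemma triv_mx_repr : mx_repr G (fun _ => 1%:M : 'M[F]_1).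
Proof. by split=> // g h _ _; rewrite mulmx1. Qed.

Definition triv_repr : mx_representation F G 1 := MxRepresentation triv_mx_repr.

(* Coordinates are row vectors in the basis (X, Y). *)
Definition X : 'rV[F]_2 := delta_mx 0 0.
Definition Y : 'rV[F]_2 := delta_mx 0 1.

(* The left action v |-> g . v on V_1, as right multiplication of row vectors:
   the rows of V1_act g are the coordinates of g . X and g . Y. *)
Definition V1_act (g : {'GL_2(2)}) : 'M[F]_2 := (map_mx iota (val g))^T.

Lemma V1_actX g :
  X *m V1_act g = iota (GLval g 0 0) *: X + iota (GLval g 1 0) *: Y.
Proof.
rewrite -rowE; apply/rowP=> j; rewrite !mxE; case: j => [[|[|//]]] lt_j /=.
  rewrite mulr1 mulr0 addr0; congr (iota (GLval g _ _)); exact: val_inj.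
rewrite mulr1 mulr0 add0r; congr (iota (GLval g _ _)); exact: val_inj.
Qed.

Lemma V1_actY g :
  Y *m V1_act g = iota (GLval g 0 1) *: X + iota (GLval g 1 1) *: Y.
Proof.
rewrite -rowE; apply/rowP=> j; rewrite !mxE; case: j => [[|[|//]]] lt_j /=.
  rewrite mulr1 mulr0 addr0; congr (iota (GLval g _ _)); exact: val_inj.
rewrite mulr1 mulr0 add0r; congr (iota (GLval g _ _)); exact: val_inj.
Qed.

(* An mx_representation is a right module, so the left module V_1 is encoded
   as usual by v * g := g^-1 . v; submodules, homomorphisms, quotients and
   tensor products (with the diagonal action) are the same on both sides. *)
Lemma V1_mx_repr : mx_repr G (fun g => V1_act g^-1%g).
Proof.
split=> [|g h _ _]; rewrite /V1_act; first by rewrite invg1 map_mx1 trmx1.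
by rewrite invMg -trmx_mul -map_mxM.
Qed.

Definition V1 : mx_representation F G 2 := MxRepresentation V1_mx_repr.

Definition V : mx_representation F G (2 * 2) := prod_repr V1 V1.

Local Notation "u *t v" := (tprod u v : 'rV[F]_(2 * 2)) (at level 40).

Definition one_sub : 'M[F]_(2 * 2) := <<X *t Y - Y *t X>>%MS.

Definition std_sub : 'M[F]_(2 * 2) :=
  (<<X *t X + X *t Y - Y *t X>> + <<Y *t Y + X *t Y - Y *t X>>)%MS.

End StandardRepresentation.

(* Main.v *)
(** Put e = X*Y - Y*X, which spans a trivial submodule because g acts on it by
    det g = 1. Since the entries a, c of a column of g are 0 or 1 and not both
    0, we have a c + 1 = a + c in characteristic 2, so X |-> X*X + e,
    Y |-> Y*Y + e embeds V_1 in V. Hence S = 1 + std is semisimple of dimension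
    3, so that the socle is S or V, and V/S is a line, hence simple. The socle
    is not V, as S has no stable complement. *)
Require Import Defs.
From HB Require Import structures.
From mathcomp Require Import all_boot all_order all_algebra all_fingroup.
From mathcomp Require Import all_solvable all_field all_character.

Set Implicit Arguments.
Unset Strict Implicit.
Unset Printing Implicit Defensive.

Import GRing.Theory.
Local Open Scope ring_scope.

(** * Submodules and socles under intertwining maps *)

Section Intertwiners.

Variables (F : fieldType) (gT : finGroupType) (G : {group gT}).
Variables (n1 n2 : nat).
Variables (rG1 : mx_representation F G n1) (rG2 : mx_representation F G n2).
Variable B : 'M[F]_(n1, n2).
Hypothesis homB : forall x, x \in G -> rG1 x *m B = B *m rG2 x.

Lemma intertwiner_module m (U : 'M_(m, n1)) :
  mxmodule rG1 U -> mxmodule rG2 (U *m B).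
Proof.
move=> modU; apply/mxmoduleP=> x Gx.
by rewrite -mulmxA -homB // mulmxA submxMr ?(mxmoduleP modU).
Qed.

Hypothesis freeB : row_free B.

(** [B], viewed as a map onto its row space [U], is the required isomorphism; this serves for both
    [one_sub] and [std_sub]. *)
Lemma intertwiner_rsim (U : 'M_n2) (modU : mxmodule rG2 U) :
  (B :=: U)%MS -> mx_rsim (submod_repr modU) rG1.
Proof.
move=> defU; apply: mx_rsim_sym; have sBU : (B <= U)%MS by rewrite defU.
exists (in_submod U B) => [||x Gx].
- by rewrite -defU; apply/esym/eqP.
- by rewrite /row_free mxrank_in_submod.
by rewrite -in_submodJ // -homB // -[RHS]mulmxA.
Qed.

Lemma intertwiner_simple (U : 'M_n1) :
  mxsimple rG1 U -> mxsimple rG2 <<U *m B>>%MS.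
Proof.
move=> [modU nzU simU]; split=> [||W modW].
- by rewrite (eqmx_module _ (genmxE _)) intertwiner_module.
- by rewrite (eqmx_eq0 (genmxE _)) -mxrank_eq0 mxrankMfree // mxrank_eq0.
(* Here [W = D *m U *m B], so [D' = D *m U] spans the preimage of [W] under [B]. Injectivity of [B]
   makes [D'] stable, and simplicity of [U] then forces [U <= D']. *)
rewrite !genmxE => /submxP[D defW] nzW; set D' : 'M_(n2, n1) := D *m U.
have defW' : D' *m B = W by rewrite -mulmxA.
rewrite -{}defW' in modW nzW *.
have nzD' : <<D'>>%MS != 0.
  rewrite (eqmx_eq0 (genmxE _)); apply: contraNneq nzW => ->.
  by rewrite mul0mx.
apply: submxMr; rewrite -(genmxE D'); apply: simU => //.
  rewrite (eqmx_module _ (genmxE _)); apply/mxmoduleP=> x Gx.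
  have /submxP[C defC] := mxmoduleP modW x Gx.
  apply/submxP; exists C; apply: (row_free_inj freeB).
  by rewrite -[LHS]mulmxA homB // [LHS]mulmxA defC mulmxA.
by rewrite genmxE submxMl.
Qed.

(** The socle is a sum of simple submodules, and an injective intertwiner maps each of them onto a
    simple submodule. *)
Lemma intertwiner_Socle (s1 : socleType rG1) (s2 : socleType rG2) :
  (Socle s1 *m B <= Socle s2)%MS.
Proof.
have [I W S simW defS _] := Socle_semisimple s1.
rewrite -(eqmxMr B defS) /S sumsmxMr_gen; apply/sumsmx_subP=> i _.
exact/simple_Socle/intertwiner_simple.
Qed.

End Intertwiners.

(** * Steps of the socle filtration *)

Section SocleFiltration.

Variables (F : decFieldType) (gT : finGroupType) (G : {group gT}) (n : nat).
Variable rG : mx_representation F G n.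

Lemma soc_next_sup (U : 'M[F]_n) (modU : mxmodule rG U) :
  (U <= soc_next modU)%MS.
Proof. exact: addsmxSl. Qed.

Lemma soc_next_semisimple (U : 'M[F]_n) (modU : mxmodule rG U) :
  mxsemisimple (factmod_repr modU) 1%:M -> (soc_next modU :=: 1%:M)%MS.
Proof.
move=> /(semisimple_Socle (DecSocleType _)) sub1S.
apply/eqmxP; rewrite submx1 /= -(in_factmodsK (submx1 U)) addsmxS //.
by rewrite val_factmodS (submx_trans (submx1 _)).
Qed.

(** The quotient by 0 has its own coordinate space, so it is only isomorphic to the module. Each
    inclusion transports a socle along one of the mutually inverse maps [val_factmod] and
    [in_factmod 0]. *)
Lemma soc_next0 (mod0 : mxmodule rG 0) :
  (soc_next mod0 :=: Socle (DecSocleType rG))%MS.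
Proof.
(* For a general submodule this holds only modulo that submodule; here the correction lies in 0. *)
have K m (W : 'M_(m, n)) : val_factmod (in_factmod 0 W) = W.
  rewrite -[RHS](add_sub_fact_mod 0); have := val_submodP (in_submod 0 W).
  by rewrite submx0 => /eqP->; rewrite add0r.
apply: eqmx_trans (adds0mx _ _) _; apply/eqmxP/andP; split.
  rewrite val_factmodE; apply: intertwiner_Socle => [x Gx|].
    rewrite -val_factmodE -[factmod_repr _ x]mul1mx val_factmodJ //.
    by rewrite K.
  apply/row_freeP; exists (in_factmod 0 1%:M).
  by rewrite -in_factmodE val_factmodK.
rewrite -{1}[Socle _]K val_factmodS in_factmodE.
apply: intertwiner_Socle => [x Gx|].
  by rewrite -in_factmodE -[rG x]mul1mx in_factmodJ.
apply/row_freeP; exists (val_factmod 1%:M).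
by rewrite -val_factmodE K.
Qed.

Lemma factmod_simple (U : 'M[F]_n) (modU : mxmodule rG U) :
  (\rank U).+1 = n -> mxsimple (factmod_repr modU) 1%:M.
Proof.
move=> rU; apply: linear_mxsimple; first exact: mxmodule1.
by rewrite mxrank1 mxrank_coker -{1}rU subSnn.
Qed.

End SocleFiltration.

(** * Coordinates on [V1] and on its tensor square *)

Lemma det_mx22 (R : comNzRingType) (A : 'M[R]_2) :
  \det A = A 0 0 * A 1 1 - A 0 1 * A 1 0.
Proof.
rewrite (expand_det_row _ 0) big_ord_recl big_ord1 /cofactor !det_mx11 !mxE /=.
rewrite expr0 expr1 mul1r mulN1r mulrN.
by congr (A _ _ * A _ _ - A _ _ * A _ _); apply: val_inj.
Qed.

Section TensorSquare.

Variables (F : fieldType) (iota : {rmorphism 'F_2 -> F}).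

Local Notation G := ('GL_2(2)%G).
Local Notation "u *t v" := (tprod u v : 'rV[F]_(2 * 2)) (at level 40).
Local Notation X := (X F).
Local Notation Y := (Y F).

Lemma pchar2 : 2 \in [pchar F].
Proof. exact: (rmorph_pchar iota (pchar_Fp (isT : prime 2))). Qed.

(** Coordinates in the basis [X *t X], [X *t Y], [Y *t X], [Y *t Y], in this order. *)
Definition row4 (a b c d : F) : 'rV[F]_(2 * 2) := \row_j [:: a; b; c; d]`_j.

Lemma row4_0 : 0 = row4 0 0 0 0.
Proof. by apply/rowP=> -[[|[|[|[|//]]]] lt_j]; rewrite !mxE. Qed.

Lemma row4P (u : 'rV[F]_(2 * 2)) :
  {abcd : F * F * F * F | let: (a, b, c, d) := abcd in u = row4 a b c d}.
Proof.
pose o k (lt_k : (k < 4)%N) : 'I_(2 * 2) := Ordinal lt_k.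
exists (u 0 (o 0 isT), u 0 (o 1 isT), u 0 (o 2 isT), u 0 (o 3 isT)).
apply/rowP=> -[[|[|[|[|//]]]] lt_j]; rewrite mxE /=;
  by congr (u _ _); apply: val_inj.
Qed.

Lemma row4_inj a b c d a' b' c' d' :
  row4 a b c d = row4 a' b' c' d' -> [/\ a = a', b = b', c = c' & d = d'].
Proof.
pose o k (lt_k : (k < 4)%N) : 'I_(2 * 2) := Ordinal lt_k.
move/rowP=> E.
by have:= (E (o 0 isT), E (o 1 isT), (E (o 2 isT), E (o 3 isT)));
   rewrite !mxE /= => -[[-> ->] [-> ->]].
Qed.

Lemma row4D a b c d a' b' c' d' :
  row4 a b c d + row4 a' b' c' d' = row4 (a + a') (b + b') (c + c') (d + d').
Proof. by apply/rowP=> -[[|[|[|[|//]]]] lt_j]; rewrite !mxE. Qed.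

Lemma row4N a b c d : - row4 a b c d = row4 (- a) (- b) (- c) (- d).
Proof. by apply/rowP=> -[[|[|[|[|//]]]] lt_j]; rewrite !mxE. Qed.

Lemma row4Z k a b c d :
  k *: row4 a b c d = row4 (k * a) (k * b) (k * c) (k * d).
Proof. by apply/rowP=> -[[|[|[|[|//]]]] lt_j]; rewrite !mxE. Qed.

Lemma tprod_row4 (u v : 'rV[F]_2) :
  u *t v =
    row4 (u 0 0 * v 0 0) (u 0 0 * v 0 1) (u 0 1 * v 0 0) (u 0 1 * v 0 1).
Proof.
apply/rowP=> -[k lt_k]; rewrite !mxE /=; case: splitP => // i _.
case: k lt_k => [|[|[|[|//]]]] lt_k; rewrite !mxE;
  repeat (case: splitP => [] [[|[|?]] ?] //= _; rewrite !mxE).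
all: by rewrite [i]ord1; congr (u _ _ * v _ _); apply: val_inj.
Qed.

Lemma rowXY (u : 'rV[F]_2) : u = u 0 0 *: X + u 0 1 *: Y.
Proof.
rewrite {1}[u]row_sum_delta big_ord_recl big_ord1.
by congr (u _ _ *: delta_mx _ _ + u _ _ *: delta_mx _ _); apply: val_inj.
Qed.

Lemma coordXY a b :
  ((a *: X + b *: Y) 0 0 = a) * ((a *: X + b *: Y) 0 1 = b).
Proof. by split; rewrite !mxE /= ?mulr1 ?mulr0 ?addr0 ?add0r. Qed.

Lemma coordE : ((X 0 0 = 1) * (X 0 1 = 0)) * ((Y 0 0 = 0) * (Y 0 1 = 1)).
Proof. by rewrite !mxE. Qed.

Lemma eqXY m (A B : 'M[F]_(2, m)) : X *m A = X *m B -> Y *m A = Y *m B -> A = B.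
Proof.
move=> eqX eqY; apply/row_matrixP=> i; rewrite !rowE.
by rewrite [delta_mx 0 i]rowXY !mulmxDl -!scalemxAl eqX eqY.
Qed.

Lemma row4E a b c d :
  row4 a b c d =
    a *: (X *t X) + b *: (X *t Y) + c *: (Y *t X) + d *: (Y *t Y).
Proof.
rewrite !tprod_row4 !coordE !row4Z !row4D.
by rewrite !(mulr0, mulr1, addr0, add0r).
Qed.

(** * The group action in coordinates *)

Lemma tprodV (u v : 'rV[F]_2) g :
  (u *t v) *m V iota g = (u *m V1 iota g) *t (v *m V1 iota g).
Proof. exact/esym/(tprodE u (V1 iota g) v (V1 iota g)). Qed.

Lemma row4V a b c d g (x := X *m V1 iota g) (y := Y *m V1 iota g) :
  row4 a b c d *m V iota g =
    a *: (x *t x) + b *: (x *t y) + c *: (y *t x) + d *: (y *t y).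
Proof. by rewrite row4E !mulmxDl -!scalemxAl !tprodV. Qed.

Lemma F2_0or1 (x : 'F_2) : x = 0 \/ x = 1.
Proof. by case: x => [[|[|//]] lt_x]; [left | right]; apply: val_inj. Qed.

Lemma V1_coords g : exists a b c d : F,
  [/\ X *m V1 iota g = a *: X + c *: Y, Y *m V1 iota g = b *: X + d *: Y,
      a * d - b * c = 1 &
      forall x, x \in [:: a; b; c; d] -> x = 0 \/ x = 1].
Proof.
(* [V1] lets [g] act through the left action of its inverse, hence the entries of [g^-1]. *)
pose h : 'M['F_2]_2 := GLval g^-1%g.
exists (iota (h 0 0)), (iota (h 0 1)), (iota (h 1 0)), (iota (h 1 1)).
split; [exact: V1_actX | exact: V1_actY | | ].
  rewrite -!rmorphM -rmorphB -det_mx22.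
  have := GL_det g^-1%g; rewrite -/h.
  by case: (F2_0or1 (\det h)) => -> //; rewrite rmorph1.
have iota01 y : iota y = 0 \/ iota y = 1.
  by case: (F2_0or1 y) => ->; rewrite ?rmorph0 ?rmorph1; [left | right].
by move=> x; rewrite !inE => /or4P[] /eqP->.
Qed.

Lemma GL_elt (a b c d : 'F_2) : a * d - b * c = 1 ->
  exists g : {'GL_2(2)},
    X *m V1 iota g = iota a *: X + iota c *: Y /\
    Y *m V1 iota g = iota b *: X + iota d *: Y.
Proof.
move=> det1; pose h : 'M['F_2]_2 :=
  \matrix_(i, j) (if i == 0 then if j == 0 then a else b
                  else if j == 0 then c else d).
have uh : h \is a GRing.unit.
  by rewrite unitmxE det_mx22 !mxE /= det1 unitr1.
pose g : {'GL_2(2)} := FinRing.Unit uh.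
(* This inverse cancels the one built into [V1]. *)
exists g^-1%g; rewrite /= invgK V1_actX V1_actY.
by rewrite /g /= !mxE.
Qed.

(** * The trivial and the standard submodule *)

Lemma oppF (x : F) : - x = x.
Proof. exact: (oppr_pchar2 pchar2). Qed.

Lemma addF (x : F) : x + x = 0.
Proof. exact: (addrr_pchar2 pchar2). Qed.

Lemma oneE : X *t Y - Y *t X = row4 0 1 1 0.
Proof.
rewrite !tprod_row4 !coordE row4N row4D.
by rewrite !(mulr0, mulr1, addr0, add0r, oppF).
Qed.

Lemma stdXE : X *t X + X *t Y - Y *t X = row4 1 1 1 0.
Proof.
rewrite !tprod_row4 !coordE row4N !row4D.
by rewrite !(mulr0, mulr1, addr0, add0r, oppF).
Qed.

Lemma stdYE : Y *t Y + X *t Y - Y *t X = row4 0 1 1 1.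
Proof.
rewrite !tprod_row4 !coordE row4N !row4D.
by rewrite !(mulr0, mulr1, addr0, add0r, oppF).
Qed.

(** The matrix of the embedding of [V1] that adds [e], with coordinates (0, 1, 1, 0), to the square
    of each basis vector. *)
Definition std_mx : 'M[F]_(2, 2 * 2) :=
  \matrix_i (if i == 0 then row4 1 1 1 0 else row4 0 1 1 1).

Lemma std_mxX : X *m std_mx = row4 1 1 1 0.
Proof. by rewrite -rowE rowK. Qed.

Lemma std_mxY : Y *m std_mx = row4 0 1 1 1.
Proof. by rewrite -rowE rowK. Qed.

Lemma mul_std_mx (u : 'rV[F]_2) :
  u *m std_mx = row4 (u 0 0) (u 0 0 + u 0 1) (u 0 0 + u 0 1) (u 0 1).
Proof.
rewrite [u in LHS]rowXY mulmxDl -!scalemxAl std_mxX std_mxY !row4Z row4D.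
by rewrite !(mulr0, mulr1, addr0, add0r).
Qed.

Lemma std_mx_free : row_free std_mx.
Proof.
apply: inj_row_free => u; rewrite mul_std_mx row4_0.
by case/row4_inj=> p0 _ _ q0; rewrite (rowXY u) p0 q0 !scale0r addr0.
Qed.

(** At [X] the two sides have coordinates (a, a + c, a + c, c) and (a^2, a c + 1, a c + 1, c^2).
    They agree when a and c are 0 or 1 and not both 0; [Y] is treated alike with b and d. *)
Lemma std_mx_hom :
  {in G, forall g, V1 iota g *m std_mx = std_mx *m V iota g}.
Proof.
move=> g _; have [a [b [c [d [Xg Yg det1 ent01]]]]] := V1_coords g.
apply: eqXY; rewrite [in LHS]mulmxA [in RHS]mulmxA ?Xg ?Yg mul_std_mx coordXY.
all: rewrite ?std_mxX ?std_mxY row4V Xg Yg.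
all: rewrite !tprod_row4 !coordXY !row4Z !row4D.
all: have {ent01} [Ha Hb Hc Hd] : [/\ a = 0 \/ a = 1, b = 0 \/ b = 1,
    c = 0 \/ c = 1 & d = 0 \/ d = 1]
  by split; apply: ent01; rewrite !inE eqxx ?orbT.
all: case: Ha Hb Hc Hd det1 => -> [] -> [] -> [] ->.
all: rewrite !(mul0r, mulr0, mul1r, mulr1, addr0, add0r, subr0, oppF, addF).
all: move=> // det1.
(* Only singular choices of the entries remain, and these contradict [det1]. *)
all: try by case/eqP: (oner_neq0 F); rewrite -det1 ?addF.
Qed.

(** The image of [e] is (2ab, ad + bc, ad + bc, 2cd), which in characteristic 2 is the determinant
    times [e], and the determinant is 1. *)
Lemma one_row_hom :
  {in G, forall g, triv_repr F g *m row4 0 1 1 0 = row4 0 1 1 0 *m V iota g}.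
Proof.
move=> g _; rewrite mul1mx; symmetry.
have [a [b [c [d [Xg Yg det1 _]]]]] := V1_coords g.
rewrite row4V Xg Yg !tprod_row4 !coordXY !row4Z !row4D.
rewrite !(mul0r, mul1r, add0r, addr0).
rewrite [b * a]mulrC [d * c]mulrC [c * b]mulrC [d * a]mulrC !addF.
by rewrite [b * c + _]addrC -[b * c]oppF det1.
Qed.

Lemma std_subE : (std_mx :=: std_sub F)%MS.
Proof.
apply/eqmxP/andP; rewrite /std_sub stdXE stdYE; split; last first.
  by rewrite addsmx_sub !genmxE -std_mxX -std_mxY !submxMl.
apply/row_subP=> i; rewrite rowK.
case: ifP => _; last by rewrite (submx_trans _ (addsmxSr _ _)) ?genmxE.
by rewrite (submx_trans _ (addsmxSl _ _)) ?genmxE.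
Qed.

Lemma one_subE : (row4 0 1 1 0 :=: one_sub F)%MS.
Proof. by rewrite /one_sub oneE; apply/eqmx_sym/genmxE. Qed.

Lemma one_row_neq0 : row4 0 1 1 0 != 0.
Proof.
by apply/eqP; rewrite row4_0 => /row4_inj[_ /eqP]; rewrite oner_eq0.
Qed.

(** A vector of [std_sub] is (p, p + q, p + q, q) and one of [one_sub] is (0, k, k, 0); the outer
    coordinates give p = q = 0, whence k = 0. *)
Lemma one_std_disjoint : (one_sub F :&: std_sub F = 0)%MS.
Proof.
apply/eqP/rowV0P => w; rewrite sub_capmx -one_subE -std_subE.
case/andP=> /sub_rVP[k ->] /submxP[u]; rewrite mul_std_mx row4Z => E.
have [p0 k0 _ q0] := row4_inj E.
rewrite -{}p0 -{}q0 mulr0 addr0 in k0.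
by rewrite k0 mulr0 -row4_0.
Qed.

Lemma one_sub_module : mxmodule (V iota) (one_sub F).
Proof.
rewrite -(eqmx_module _ one_subE) -[row4 _ _ _ _]mul1mx.
exact: (intertwiner_module one_row_hom (mxmodule1 _)).
Qed.

Lemma std_sub_module : mxmodule (V iota) (std_sub F).
Proof.
rewrite -(eqmx_module _ std_subE) -[std_mx]mul1mx.
exact: (intertwiner_module std_mx_hom (mxmodule1 _)).
Qed.

Lemma one_sub_rsim (modU : mxmodule (V iota) (one_sub F)) :
  mx_rsim (submod_repr modU) (triv_repr F).
Proof.
apply: (intertwiner_rsim one_row_hom) one_subE.
by rewrite /row_free rank_rV one_row_neq0.
Qed.

Lemma std_sub_rsim (modU : mxmodule (V iota) (std_sub F)) :
  mx_rsim (submod_repr modU) (V1 iota).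
Proof. exact: (intertwiner_rsim std_mx_hom std_mx_free) std_subE. Qed.

(** * Irreducibility of [V1], by means of a swap and a shear *)

Lemma swap_elt : exists g : {'GL_2(2)},
  X *m V1 iota g = Y /\ Y *m V1 iota g = X.
Proof.
have [|g [Xg Yg]] := @GL_elt 0 1 1 0; first exact: val_inj.
by exists g; rewrite Xg Yg rmorph0 rmorph1 !scale0r !scale1r addr0 add0r.
Qed.

Lemma shear_elt : exists g : {'GL_2(2)},
  X *m V1 iota g = X /\ Y *m V1 iota g = X + Y.
Proof.
have [|g [Xg Yg]] := @GL_elt 1 1 0 1; first exact: val_inj.
by exists g; rewrite Xg Yg rmorph0 rmorph1 !scale0r !scale1r addr0.
Qed.

Lemma V1_irr : mx_irreducible (V1 iota).
Proof.
apply/mx_irrP; split=> // U modU nzU.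
have stableU (w : 'rV_2) g : (w <= U)%MS -> (w *m V1 iota g <= U)%MS.
  by move=> Uw; apply: mxmodule_trans (in_setT g) Uw.
have [s [Xs Ys]] := swap_elt; have [t [Xt Yt]] := shear_elt.
(* The shear [t] fixes [X] and adds [X] to [Y], so it moves [w] by its [Y]-coordinate times [X]. *)
have unX (w : 'rV_2) : (w <= U)%MS -> w 0 1 != 0 -> (X <= U)%MS.
  move=> Uw nzq; rewrite -(eqmx_scale X nzq).
  have -> : w 0 1 *: X = w *m V1 iota t - w.
    rewrite [in _ *m _](rowXY w) [X in _ - X](rowXY w) mulmxDl.
    rewrite -!scalemxAl Xt Yt.
    by apply/(canRL (addrK _)); rewrite scalerDr addrCA.
  by rewrite addmx_sub ?eqmx_opp ?stableU.
have [w Uw nzw] : exists2 w : 'rV_2, (w <= U)%MS & w != 0.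
  by exists (nz_row U); rewrite ?nz_row_sub ?nz_row_eq0.
have UX : (X <= U)%MS.
  have [q0 | ] := eqVneq (w 0 1) 0; last exact: unX.
  (* When the [Y]-coordinate of [w] is 0, the swap puts its nonzero [X]-coordinate in that place. *)
  apply: unX (stableU _ s Uw) _; apply: contraNneq nzw => p0.
  move: p0; rewrite {1}(rowXY w) mulmxDl -!scalemxAl Xs Ys addrC coordXY => p0.
  by rewrite (rowXY w) p0 q0 !scale0r addr0.
have UY : (Y <= U)%MS by rewrite -Xs stableU.
rewrite -sub1mx; apply/row_subP=> i.
by rewrite (rowXY (row i _)) addmx_sub ?scalemx_sub.
Qed.

(** * The socle of [V] *)

Local Notation S := (one_sub F + std_sub F)%MS.

Lemma rank_soc : \rank S = 3.
Proof.
rewrite (mxrank_disjoint_sum one_std_disjoint) -one_subE -std_subE.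
by rewrite rank_rV one_row_neq0 (eqP std_mx_free).
Qed.

Lemma soc_module : mxmodule (V iota) S.
Proof. exact: addsmx_module one_sub_module std_sub_module. Qed.

Lemma soc_semisimple : mxsemisimple (V iota) S.
Proof.
apply: addsmx_semisimple; apply: mxsimple_semisimple.
  apply: linear_mxsimple one_sub_module _.
  by rewrite -one_subE rank_rV one_row_neq0.
apply/(submod_mx_irr std_sub_module).
exact: mx_rsim_irr (mx_rsim_sym (std_sub_rsim _)) V1_irr.
Qed.

(* A complement of S would be a line; the swap of X and Y is an involution, so
   in characteristic 2 it fixes that line pointwise, but its fixed vectors
   (a, b, b, a) all lie in S. *)
Lemma not_semisimple : mxsemisimple (V iota) 1%:M -> False.
Proof.
move=> /mxsemisimple_reducible/(_ S soc_module (submx1 _))[W modW defSW dxSW].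
have [s [Xs Ys]] := swap_elt.
have swapE a b c d : row4 a b c d *m V iota s = row4 d c b a.
  rewrite row4V Xs Ys !tprod_row4 !coordE !row4Z !row4D.
  by rewrite !(mulr0, mulr1, addr0, add0r).
have rW : \rank W = 1.
  apply: (@addnI 3); rewrite -rank_soc -(mxdirectP dxSW) /= defSW mxrank1.
  by rewrite rank_soc.
have nzw : nz_row W != 0 by rewrite nz_row_eq0 -mxrank_eq0 rW.
have sWw : (W <= nz_row W)%MS.
  by rewrite -(geq_leqif (mxrank_leqif_sup (nz_row_sub W))) rW rank_rV nzw.
have /sub_rVP[k] : (nz_row W *m V iota s <= nz_row W)%MS.
  apply: submx_trans sWw.
  by apply: mxmodule_trans (in_setT s) (nz_row_sub W).
have [[[[a b] c] d] def_w] := row4P (nz_row W).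
rewrite def_w swapE row4Z => /row4_inj[Ed Ec Eb Ea].
(* Since [d = k * a] and [c = k * b], a nonzero vector has [a] or [b] nonzero; applying the swap
   twice multiplies that coordinate by [k ^+ 2]. *)
have k2 : k ^+ 2 = 1.
  have fix_k2 x y : y = k * x -> x = k * y -> x != 0 -> k ^+ 2 = 1.
    by move=> -> Ex nzx; apply: (mulIf nzx); rewrite mul1r [RHS]Ex expr2 mulrA.
  have [a0 | ] := eqVneq a 0; last exact: fix_k2 Ed Ea.
  have [b0 | ] := eqVneq b 0; last exact: fix_k2 Ec Eb.
  case/eqP: nzw; rewrite def_w Ed Ec a0 b0 !mulr0; exact/esym/row4_0.
have k1 : k = 1.
  by move/eqP: k2; rewrite sqrf_eq1 oppF orbb => /eqP.
have S_w : (nz_row W <= S)%MS.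
  (* With [k = 1] the vector is (a, b, b, a); the two multiples of [a] cancel in the middle
     coordinates. *)
  have -> : nz_row W =
      a *: row4 1 1 1 0 + a *: row4 0 1 1 1 + b *: row4 0 1 1 0.
    rewrite def_w Ed Ec k1 !row4Z !row4D !(mul1r, mulr1, mulr0, addr0, add0r).
    by rewrite addF add0r.
  rewrite -std_mxX -std_mxY addmx_sub ?scalemx_sub //.
    rewrite addmx_sub ?scalemx_sub // (submx_trans (submxMl _ _)) //.
      by rewrite std_subE addsmxSr.
    by rewrite std_subE addsmxSr.
  by rewrite one_subE addsmxSl.
case/negP: nzw; rewrite -submx0 -(mxdirect_addsP dxSW) sub_capmx S_w.
exact: nz_row_sub.
Qed.

(** [S] has codimension 1, so no subspace lies strictly between it and the whole space. *)
Lemma soc_sup_full (U : 'M[F]_(2 * 2)) :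
  (S <= U)%MS -> ~~ (U <= S)%MS -> (U :=: 1%:M)%MS.
Proof.
move=> sSU nsUS; apply/eqmxP; rewrite submx1 sub1mx.
rewrite /row_full eqn_leq rank_leq_col.
by have := @rank_ltmx _ _ _ _ S U; rewrite /ltmx sSU nsUS rank_soc; apply.
Qed.

(** [S] is semisimple and so lies in the socle. A larger socle would be the whole space and make [V]
    semisimple. *)
Lemma Socle_V (sV : socleType (V iota)) : (Socle sV :=: S)%MS.
Proof.
have sSS := semisimple_Socle sV soc_semisimple.
apply/eqmxP; rewrite sSS andbT; apply/idPn => nsSS.
apply: not_semisimple; apply: eqmx_semisimple (soc_sup_full sSS nsSS) _.
exact: Socle_semisimple.
Qed.

End TensorSquare.

Theorem proposition3p9 (F : closedFieldType) (iota : {rmorphism 'F_2 -> F})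
    (algF : forall x : F, algebraicOver iota x) :
  (exists mod_one : mxmodule (V iota) (one_sub F),
     mx_rsim (submod_repr mod_one) (triv_repr F)) /\
  (exists mod_std : mxmodule (V iota) (std_sub F),
     mx_rsim (submod_repr mod_std) (V1 iota)) /\
  (one_sub F :&: std_sub F = 0)%MS /\
  (soc (V iota) 0 :=: (0 : 'M[F]_(2 * 2)))%MS /\
  (soc (V iota) 1 :=: one_sub F + std_sub F)%MS /\
  (forall i : nat, soc (V iota) i.+2 :=: (1%:M : 'M[F]_(2 * 2)))%MS /\
  (Socle (DecSocleType (V iota)) :=: one_sub F + std_sub F)%MS /\
  (exists mod_soc : mxmodule (V iota) (one_sub F + std_sub F)%MS,
     inhabited (mxsemisimple (factmod_repr mod_soc) 1%:M)).
Proof.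
pose S := (one_sub F + std_sub F)%MS.
have soc1 : (soc (V iota) 1 :=: S)%MS.
  exact: eqmx_trans (soc_next0 _) (Socle_V _).
(* Stated up to equality of row spaces, because the first term of the filtration need not be the
   same matrix as [S]. *)
have fact_simple U (modU : mxmodule (V iota) U) :
    (U :=: S)%MS -> mxsemisimple (factmod_repr modU) 1%:M.
  move=> defU; apply/mxsimple_semisimple/factmod_simple.
  by rewrite defU (rank_soc iota).
(* The second term is everything because the quotient by the first is a line; the later terms
   contain it. *)
have soc2 i : (soc (V iota) i.+2 :=: (1%:M : 'M[F]_(2 * 2)))%MS.
  elim: i => [|i IHi]; first exact/soc_next_semisimple/fact_simple/soc1.
  apply/eqmxP; rewrite submx1 -IHi; exact: soc_next_sup.
split; first by exists (one_sub_module iota); apply: one_sub_rsim.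
split; first by exists (std_sub_module iota); apply: std_sub_rsim.
split; first exact: one_std_disjoint iota.
split; first by [].
do 2![split=> //]; split; first exact: Socle_V.
by exists (soc_module iota); constructor; apply: fact_simple.
Qed.
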